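(* Let $n \in \mathbb{N}$ and let $h = \left\lfloor \frac{n^2}{4} \right\rfloor$. Let $q \in \{a,b\}^*$ be a word which contains every word of length $n-1$ in $\{a,b\}^*$ as a factor. Let $u = q^{h} a q^{h}$ and $v = q^{h} b q^{h}$. Then the semigroup identity $u[a \mapsto ab, b \mapsto ba] = v[a \mapsto ab, b \mapsto ba]$ is satisfied by the plactic monoid $\mathbb{P}_n$ of rank $n$.
   Context: $\mathbb{N} = \{1,2,\dots\}$. For an alphabet $\Sigma$, $\Sigma^*$ is the monoid of all words over $\Sigma$ under concatenation and $\Sigma^+$ the subsemigroup of non-empty words. A word $p$ is a factor of a word $q$ if $q = spt$ for some words $s,t \in \Sigma^*$. For $w \in \{a,b\}^+$, $w[a \mapsto ab, b \mapsto ba]$ denotes the word in $\{a,b\}^+$ obtained from $w$ by simultaneously replacing each letter $a$ by $ab$ and each letter $b$ by $ba$. A semigroup identity ''$u=v$'' is a pair of distinct non-empty words over an alphabet $\Sigma$; a semigroup $S$ satisfies $u=v$ if every semigroup morphism $\Sigma^+ \to S$ maps $u$ and $v$ to the same element of $S$. The plactic monoid of rank $n$, $\mathbb{P}_n$, is the monoid generated by $\{1,\dots,n\}$ subject to the Knuth relations: $bca = bac$ for $1 \le a < b \le c \le n$, and $cab = acb$ for $1 \le a \le b < c \le n$. *)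

(* Defs.v *)
From HB Require Import structures.
From mathcomp Require Import all_boot.
From mathcomp Require Import boolp.

Set Implicit Arguments.
Unset Strict Implicit.
Unset Printing Implicit Defensive.

Local Open Scope group_scope.
Local Open Scope quotient_scope.

(** * Free monoids and free semigroups *)

Definition word (A : Type) : Type := seq A.

HB.instance Definition _ (A : choiceType) := Choice.on (word A).
HB.instance Definition _ (A : choiceType) :=
  isMonoid.Build (word A) (@catA A) (@cat0s A) (@cats0 A).

Definition is_nonempty (A : choiceType) (w : word A) : bool := w != 1.

Record nonempty_word (A : choiceType) := NonemptyWord {
  nonempty_word_val :> word A;
  _ : is_nonempty nonempty_word_val
}.

HB.instance Definition _ (A : choiceType) :=
  [isSub for @nonempty_word_val A].
HB.instance Definition _ (A : choiceType) :=
  [Choice of nonempty_word A by <:].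

Fact nonempty_mulg_closed (A : choiceType) : mulg_closed (@is_nonempty A).
Proof. by move=> [|x u] [|y v]. Qed.

HB.instance Definition _ (A : choiceType) :=
  SubChoice_isSubSemigroup.Build (word A) (@is_nonempty A) (nonempty_word A)
    (@nonempty_mulg_closed A).

Definition generator (A : choiceType) (x : A) : nonempty_word A :=
  @NonemptyWord A [:: x] isT.

(** * Substitutions *)

Fact subst_nonempty (A B : choiceType) (f : A -> nonempty_word B)
    (w : nonempty_word A) :
  is_nonempty (\prod_(x <- (w : word A)) (f x : word B)).
Proof.
case: w => [[|x w] //= _]; rewrite big_cons.
by case: (f x) => [[|y u]].
Qed.

Definition subst (A B : choiceType) (f : A -> nonempty_word B)
    (w : nonempty_word A) : nonempty_word B :=
  NonemptyWord (subst_nonempty f w).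

(** * Semigroup identities *)

Definition is_identity (A : choiceType) (u v : nonempty_word A) : Prop :=
  u <> v.

Definition satisfies (S : semigroupType) (A : choiceType)
    (u v : nonempty_word A) : Prop :=
  forall phi : {multiplicative nonempty_word A -> S}, phi u = phi v.

(** * Monoid presentations *)

Section Presentation.
Variables (A : choiceType) (R : word A -> word A -> Prop).

Inductive congruence : word A -> word A -> Prop :=
| congruence_rel u v : R u v -> congruence u v
| congruence_refl u : congruence u u
| congruence_sym u v : congruence u v -> congruence v u
| congruence_trans u v w :
    congruence u v -> congruence v w -> congruence u w
| congruence_mul u u' v v' :
    congruence u u' -> congruence v v' -> congruence (u * v) (u' * v').

Definition congruenceb (u v : word A) : bool := `[< congruence u v >].

Fact congruenceb_refl : reflexive congruenceb.
Proof. by move=> u; apply/asboolP/congruence_refl. Qed.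

Fact congruenceb_sym : symmetric congruenceb.
Proof.
by move=> u v; apply/asboolP/asboolP => /congruence_sym.
Qed.

Fact congruenceb_trans : transitive congruenceb.
Proof.
move=> v u w /asboolP uv /asboolP vw.
by apply/asboolP; apply: congruence_trans uv vw.
Qed.

Canonical congruence_equiv :=
  EquivRel congruenceb congruenceb_refl congruenceb_sym congruenceb_trans.

Definition presented : Type := {eq_quot congruence_equiv}.

HB.instance Definition _ := Choice.on presented.
HB.instance Definition _ := EqQuotient.on presented.

Definition presented_mul (x y : presented) : presented :=
  \pi_presented (repr x * repr y).
Definition presented_one : presented := \pi_presented 1.

Lemma presented_eqP (u v : word A) :
  reflect (congruence u v) (u == v %[mod presented]).
Proof. by rewrite eqmodE; apply: asboolP. Qed.

Lemma congruence_repr (u : word A) : congruence (repr (\pi_presented u)) u.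
Proof. by apply/presented_eqP; rewrite reprK. Qed.

Lemma presented_mul_pi (u v : word A) :
  presented_mul (\pi_presented u) (\pi_presented v) = \pi_presented (u * v).
Proof.
by apply/eqP/presented_eqP; apply: congruence_mul; apply: congruence_repr.
Qed.

Fact presented_mulA : associative presented_mul.
Proof.
move=> x y z; rewrite -[x]reprK -[y]reprK -[z]reprK.
by rewrite !presented_mul_pi !reprK mulgA.
Qed.

Fact presented_1mul : left_id presented_one presented_mul.
Proof. by move=> x; rewrite -[x]reprK presented_mul_pi mul1g. Qed.

Fact presented_mul1 : right_id presented_one presented_mul.
Proof. by move=> x; rewrite -[x]reprK presented_mul_pi mulg1. Qed.

HB.instance Definition _ :=
  isMonoid.Build presented presented_mulA presented_1mul presented_mul1.

End Presentation.

(** * The plactic monoid of rank [n] *)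

(* The generators 1 < ... < n are represented by the n elements
   0 < ... < n-1 of ['I_n]; the relations only involve their order. *)
Inductive knuth (n : nat) : word 'I_n -> word 'I_n -> Prop :=
| knuth_bca (a b c : 'I_n) :
    (a < b)%N -> (b <= c)%N -> knuth [:: b; c; a] [:: b; a; c]
| knuth_cab (a b c : 'I_n) :
    (a <= b)%N -> (b < c)%N -> knuth [:: c; a; b] [:: a; c; b].

Definition plactic (n : nat) : monoidType := presented (@knuth n).

(** * The two-letter alphabet *)

Variant letter := a | b.

Definition letter_to_bool (x : letter) : bool := if x is a then false else true.
Definition letter_of_bool (x : bool) : letter := if x then b else a.

Fact letter_to_boolK : cancel letter_to_bool letter_of_bool.
Proof. by case. Qed.

HB.instance Definition _ := Countable.copy letter (can_type letter_to_boolK).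
HB.instance Definition _ : isFinite letter := CanIsFinite letter_to_boolK.

Definition subst_ab_ba : nonempty_word letter -> nonempty_word letter :=
  subst (fun x => match x with
                  | a => generator a * generator b
                  | b => generator b * generator a
                  end).

(* Main.v *)
Require Import Defs.
From mathcomp Require Import all_boot zify.

Set Implicit Arguments.
Unset Strict Implicit.
Unset Printing Implicit Defensive.

(* A state is a subset of {0,...,n-1}, seen as k particles on distinct sites, and
   states are ordered by dominance.  Running a word along an increasing chain of
   states from P to Q, one state per letter, scores a hit for every letter that
   belongs to its state; let f_{P,Q}(w) be the largest score.  The numbers
   f_{P,Q} are plactic invariants and they determine the shapes of the
   restrictions of the tableau of w to its smallest letters, hence w up to Knuth
   equivalence.

   Under the substitution the images of ab and ba have the same content, so a
   constant state P scores the same number c(P) on every block.  Let the chain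
   run through q^h x q^h from P to Q <> P, and say c(P) <= c(Q).  Take U minimal
   in (P,Q] with c(P) <= c(U).  If P and U were too far apart there would be two
   states strictly between them whose contents add up to those of P and U, and
   one of them would contradict minimality; hence chains from P to U jump at most
   n-1 times.  Meet and join with U cut the chain, without loss, into a part from
   P to U and a part from U to Q; the jumps of the former can be packed into the
   first copy of q, because q contains the word of length n-1 that they need.
   When c(Q) < c(P) one packs into the last copy of q instead.  Each step uses up
   one copy of q and shortens the interval [P,Q], whose length is at most
   n^2/4 = h, so in the end the middle block is scored by a constant state. *)

(** * States and dominance *)

Section States.
Variable n : nat.
Implicit Types (P Q R U : {set 'I_n}) (f : nat -> nat).

Definition holds P (i : 'I_n) : nat := i \in P.

(** This counting function determines [P] and turns dominance, meet and join into pointwise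
    comparison, maximum and minimum. *)
Definition below P (x : nat) : nat := \sum_(i in P) (i < x).

Lemma below0 P : below P 0 = 0.
Proof. exact: big1. Qed.

Lemma belowS P (i : 'I_n) : below P i.+1 = below P i + holds P i.
Proof.
rewrite /holds.
have -> : (i \in P : nat) = \sum_(j in P) (j == i).
  case: (boolP (i \in P)) => iP.
    by rewrite (bigD1 i) //= eqxx big1 // => j /andP[_ /negbTE ->].
  by rewrite big1 // => j jP; case: eqP => // ji; rewrite -ji jP in iP.
rewrite -big_split; apply: eq_bigr => j _ /=.
by rewrite ltnS leq_eqVlt -val_eqE /=; case: ltngtP.
Qed.

Lemma below_ge P x : n <= x -> below P x = #|P|.
Proof.
move=> nx; rewrite -sum1_card; apply: eq_bigr => i _.
by rewrite (leq_trans (ltn_ord i)).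
Qed.

Lemma below_mono P x y : x <= y -> below P x <= below P y.
Proof.
move=> xy; apply: leq_sum => i _.
by case: (ltnP i x) => // ix; rewrite (leq_trans ix xy).
Qed.

Lemma below_step P x : below P x.+1 <= (below P x).+1.
Proof.
case: (ltnP x n) => xn; last by rewrite !below_ge ?leqW.
by rewrite (belowS P (Ordinal xn)) /holds /=; case: (_ \in _); lia.
Qed.

Lemma below_le P x : below P x <= x.
Proof. by elim: x => [|x IH]; [rewrite below0 | have := below_step P x; lia]. Qed.

Lemma below_card P x : below P x <= #|P|.
Proof. by rewrite -(below_ge P (leq_maxl n x)) below_mono // leq_maxr. Qed.

Lemma card_below P x : x <= n -> #|P| <= below P x + (n - x).
Proof.
move=> xn; rewrite -(below_ge P (leqnn n)) -{1}(subnKC xn).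
elim: (n - x) => [|k IH]; first by rewrite !addn0.
by have := below_step P (x + k); rewrite addnS; lia.
Qed.

Lemma mem_below P (i : 'I_n) : (i \in P) = (below P i < below P i.+1).
Proof. by rewrite belowS /holds; case: (_ \in _); lia. Qed.

Lemma below_inj P Q : (forall x, below P x = below Q x) -> P = Q.
Proof. by move=> e; apply/setP => i; rewrite !mem_below !e. Qed.

(** On 0, ..., n these are exactly the counting functions of states. *)
Definition profile f :=
  f 0 = 0 /\ forall x, x < n -> f x <= f x.+1 <= (f x).+1.

Definition of_profile f : {set 'I_n} := [set i : 'I_n | f i < f i.+1].

Lemma below_of_profile f x : profile f -> x <= n -> below (of_profile f) x = f x.
Proof.
case=> f0 fS; elim: x => [|x IH] xn; first by rewrite below0.
rewrite (belowS _ (Ordinal xn)) /holds /= inE /= IH ?(ltnW xn) //.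
by have := fS x xn; lia.
Qed.

Lemma card_of_profile f : profile f -> #|of_profile f| = f n.
Proof. by move=> pf; rewrite -(below_ge _ (leqnn n)) below_of_profile. Qed.

Definition dom P Q : bool :=
  [forall x : 'I_n.+1, below Q x <= below P x] && (#|P| == #|Q|).

Lemma domP P Q :
  reflect ((forall x, below Q x <= below P x) /\ #|P| = #|Q|) (dom P Q).
Proof.
apply: (iffP andP) => [[/forallP le /eqP eq]|[le eq]]; last first.
  by split; [apply/forallP => x; apply: le | apply/eqP].
split=> // x; case: (leqP x n) => [xn|/ltnW nx].
  by have := le (Ordinal (xn : x < n.+1)).
by rewrite !below_ge // eq.
Qed.

Lemma domI P Q : (forall x, x <= n -> below Q x <= below P x) ->
  #|P| = #|Q| -> dom P Q.
Proof.
move=> le eq; apply/domP; split=> // x; case: (leqP x n) => [|/ltnW nx].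
  exact: le.
by rewrite !below_ge // eq.
Qed.

Lemma dom_refl P : dom P P.
Proof. by apply/domP. Qed.

Lemma dom_trans Q P R : dom P Q -> dom Q R -> dom P R.
Proof.
move=> /domP[pq cpq] /domP[qr cqr]; apply/domP; split=> [x|].
  exact: leq_trans (qr x) (pq x).
by rewrite cpq.
Qed.

Lemma dom_anti P Q : dom P Q -> dom Q P -> P = Q.
Proof.
by move=> /domP[pq _] /domP[qp _]; apply: below_inj => x; apply/eqP; rewrite eqn_leq pq qp.
Qed.

(** * Depth as a rank function for dominance *)

Definition depth P := \sum_(0 <= x < n) below P x.

Lemma depth_dom P Q : dom P Q -> depth Q <= depth P.
Proof. by move=> /domP[pq _]; apply: leq_sum. Qed.

Lemma depth_lt P Q : dom P Q -> P <> Q -> depth Q < depth P.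
Proof.
move=> pq neq; rewrite ltn_neqAle depth_dom // andbT; apply/eqP => e.
case/domP: (pq) => le ce; apply: neq; apply: below_inj => x.
case: (ltnP x n) => [xn|nx]; last by rewrite !below_ge.
move/esym/eqP: e; rewrite /depth eq_sym => e.
have := leqif_sum (I := 'I_n) (P := xpredT) (fun i _ => leqif_eq (le i)).
case=> _; rewrite -!(big_mkord xpredT (below _)) e => /esym/forallP/(_ (Ordinal xn)).
by move/eqP.
Qed.

Lemma sum_succn m (F : nat -> nat) :
  \sum_(0 <= i < m) (F i).+1 = m + \sum_(0 <= i < m) F i.
Proof.
under eq_bigr do rewrite -add1n.
by rewrite big_split sum_nat_const_nat subn0 muln1.
Qed.

(** Passing from [m] to [m + 2] adds the end terms 0 and 1 and raises each of the [m] old terms by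
    one; the right side also grows by [m + 1]. *)
Lemma sum_minn_le m : \sum_(0 <= x < m) minn x (m - x) <= m ^ 2 %/ 4.
Proof.
have [k] := ubnP m; elim: k m => // k IH [|[|m]] hm.
- by rewrite big_nil.
- by rewrite big_nat1.
rewrite big_nat_recl // big_nat_recr //= min0n.
rewrite (_ : \sum_(0 <= i < m) _ = m + \sum_(0 <= i < m) minn i (m - i)); last first.
  by rewrite -sum_succn !big_nat; apply: eq_bigr => i; lia.
have := IH m ltac:(lia).
have -> : m.+2 ^ 2 = m.+1 * 4 + m ^ 2 by rewrite !expnS !expn0; lia.
rewrite divnMDl //; lia.
Qed.

(** With k particles, counts at [x] lie between k - (n - x) and min(k, x), so two of them differ by
    at most min(x, n - x). *)
Lemma depth_range P Q : dom P Q -> depth P <= depth Q + n ^ 2 %/ 4.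
Proof.
move=> /domP[le ce].
apply: leq_trans (leq_add (leqnn _) (sum_minn_le n)).
rewrite /depth -big_split /= !big_nat; apply: leq_sum => x /andP[_ xn].
have := below_le P x; have := below_card P x.
have := card_below Q (ltnW xn); lia.
Qed.

(** All counts vanish at 0, so only n - 1 sites can contribute a difference of one. *)
Lemma depth_near P Q : (forall x, below P x <= (below Q x).+1) ->
  depth P <= depth Q + n.-1.
Proof.
rewrite /depth => near; case: (posnP n) => [->|n_gt0]; first by rewrite !big_nil.
rewrite -(prednK n_gt0) !(big_nat_recl n.-1) //= !below0 !add0n addnC -sum_succn.
exact: leq_sum.
Qed.

(** * The lattice of states *)

Definition meet P Q := of_profile (fun x => maxn (below P x) (below Q x)).
Definition join P Q := of_profile (fun x => minn (below P x) (below Q x)).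

Lemma meet_profile P Q : profile (fun x => maxn (below P x) (below Q x)).
Proof.
split=> [|x _]; first by rewrite !below0.
have := below_step P x; have := below_step Q x.
have := below_mono P (leqnSn x); have := below_mono Q (leqnSn x); lia.
Qed.

Lemma join_profile P Q : profile (fun x => minn (below P x) (below Q x)).
Proof.
split=> [|x _]; first by rewrite !below0.
have := below_step P x; have := below_step Q x.
have := below_mono P (leqnSn x); have := below_mono Q (leqnSn x); lia.
Qed.

Lemma below_meet P Q x : x <= n ->
  below (meet P Q) x = maxn (below P x) (below Q x).
Proof. exact/below_of_profile/meet_profile. Qed.

Lemma below_join P Q x : x <= n ->
  below (join P Q) x = minn (below P x) (below Q x).
Proof. exact/below_of_profile/join_profile. Qed.

Lemma card_meet P Q : #|P| = #|Q| -> #|meet P Q| = #|P|.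
Proof.
by move=> e; rewrite (card_of_profile (meet_profile P Q)) !below_ge // -e maxnn.
Qed.

Lemma card_join P Q : #|P| = #|Q| -> #|join P Q| = #|P|.
Proof.
by move=> e; rewrite (card_of_profile (join_profile P Q)) !below_ge // -e minnn.
Qed.

(** Membership is an increment of the count, so an additive relation between counts passes to single
    letters and then to scores. *)
Lemma holds_additive P Q R U :
  (forall x, x <= n -> below P x + below Q x = below R x + below U x) ->
  forall i, holds P i + holds Q i = holds R i + holds U i.
Proof.
move=> e i; have := e i (ltnW (ltn_ord i)); have := e i.+1 (ltn_ord i).
rewrite !belowS; lia.
Qed.

Definition weight P (w : seq 'I_n) := count (fun i : 'I_n => i \in P) w.

Lemma weight_cons P i w : weight P (i :: w) = holds P i + weight P w.
Proof. by []. Qed.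

Lemma weight_additive P Q R U w :
  (forall x, x <= n -> below P x + below Q x = below R x + below U x) ->
  weight P w + weight Q w = weight R w + weight U w.
Proof.
by move=> /holds_additive e; elim: w => // i w; rewrite !weight_cons; have := e i; lia.
Qed.

Lemma meet_join_holds P Q i :
  holds (meet P Q) i + holds (join P Q) i = holds P i + holds Q i.
Proof.
by apply: holds_additive => x xn; rewrite below_meet // below_join //; lia.
Qed.

Lemma meet_dom P Q P' Q' : #|P| = #|Q| -> dom P P' -> dom Q Q' ->
  dom (meet P Q) (meet P' Q').
Proof.
move=> e /domP[p cp] /domP[q cq]; apply: domI => [x xn|]; last first.
  by rewrite !card_meet // -cp -cq.
by rewrite !below_meet //; have := p x; have := q x; lia.
Qed.

Lemma join_dom P Q P' Q' : #|P| = #|Q| -> dom P P' -> dom Q Q' ->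
  dom (join P Q) (join P' Q').
Proof.
move=> e /domP[p cp] /domP[q cq]; apply: domI => [x xn|]; last first.
  by rewrite !card_join // -cp -cq.
by rewrite !below_join //; have := p x; have := q x; lia.
Qed.

Lemma meet_l P Q : dom P Q -> meet P Q = P.
Proof.
move=> /domP[pq e]; apply: below_inj => x; case: (leqP x n) => [xn|/ltnW nx].
  by rewrite below_meet //; have := pq x; lia.
by rewrite !below_ge // card_meet.
Qed.

Lemma meet_r P Q : dom Q P -> meet P Q = Q.
Proof.
move=> /domP[pq e]; apply: below_inj => x; case: (leqP x n) => [xn|/ltnW nx].
  by rewrite below_meet //; have := pq x; lia.
by rewrite !below_ge // card_meet.
Qed.

Lemma join_l P Q : dom Q P -> join P Q = P.
Proof.
move=> /domP[pq e]; apply: below_inj => x; case: (leqP x n) => [xn|/ltnW nx].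
  by rewrite below_join //; have := pq x; lia.
by rewrite !below_ge // card_join.
Qed.

Lemma join_r P Q : dom P Q -> join P Q = Q.
Proof.
move=> /domP[pq e]; apply: below_inj => x; case: (leqP x n) => [xn|/ltnW nx].
  by rewrite below_join //; have := pq x; lia.
by rewrite !below_ge // card_join.
Qed.

Lemma of_profile_between P U f : dom P U -> profile f ->
  (forall x, x <= n -> below U x <= f x <= below P x) ->
  dom P (of_profile f) /\ dom (of_profile f) U.
Proof.
move=> /domP[pu e] pf fb.
have ef : #|of_profile f| = #|P|.
  by rewrite card_of_profile //; have := fb n (leqnn n); rewrite !below_ge // e; lia.
by split; apply: domI => [x xn|]; rewrite ?ef // below_of_profile //;
  case/andP: (fb x xn).
Qed.

(* Where the profiles of [P] and [U] differ by two or more, lowering that of [P]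
   by one and raising that of [U] by one, and then taking the join with [U] and
   the meet with [P], gives two new states with the same total content. *)
Lemma split_interval P U x : dom P U -> (below U x).+1 < below P x ->
  exists R1 R2, [/\ dom P R1 /\ dom R1 U, dom P R2 /\ dom R2 U,
    [/\ R1 <> P, R1 <> U, R2 <> P & R2 <> U]
    & forall w, weight R1 w + weight R2 w = weight P w + weight U w].
Proof.
move=> pu gap; case/domP: (pu) => le e.
pose f1 y := maxn (below U y) (below P y).-1.
pose f2 y := minn (below P y) (below U y).+1.
have pf1 : profile f1.
  split=> [|y _]; rewrite /f1 ?below0 //.
  have := below_step P y; have := below_step U y.
  have := below_mono P (leqnSn y); have := below_mono U (leqnSn y); lia.
have pf2 : profile f2.
  split=> [|y _]; rewrite /f2 ?below0 //.
  have := below_step P y; have := below_step U y.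
  have := below_mono P (leqnSn y); have := below_mono U (leqnSn y); lia.
have xn : x <= n.
  by rewrite leqNgt; apply/negP => /ltnW nx; move: gap; rewrite !below_ge // e; lia.
have [b1 b2] : below (of_profile f1) x = f1 x /\ below (of_profile f2) x = f2 x.
  by rewrite !below_of_profile.
exists (of_profile f1), (of_profile f2); split.
- by apply: of_profile_between => // y _; have := le y; rewrite /f1; lia.
- by apply: of_profile_between => // y _; have := le y; rewrite /f2; lia.
- split=> E; move: b1 b2; rewrite E /f1 /f2; lia.
move=> w; apply: weight_additive => y yn; rewrite !below_of_profile // /f1 /f2.
by have := le y; lia.
Qed.

Lemma weight_cat P w1 w2 : weight P (w1 ++ w2) = weight P w1 + weight P w2.
Proof. exact: count_cat. Qed.

Lemma short_up P Q w : dom P Q -> P <> Q -> weight P w <= weight Q w ->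
  exists U, [/\ dom P U, dom U Q, P <> U, weight P w <= weight U w
    & (forall R, dom P R -> dom R U -> weight R w <= weight U w)
      /\ depth P <= depth U + n.-1].
Proof.
move=> pq ne le.
pose good U := [&& dom P U, dom U Q, P != U & weight P w <= weight U w].
have goodQ : good Q by rewrite /good pq dom_refl le (introN eqP ne).
(* Maximal depth puts [U] as close to [P] as possible, so states strictly between them score less
   than [P]. *)
case: (arg_maxnP depth goodQ) => U /and4P[pU Uq /eqP neU leU] maxU.
have low R : dom P R -> dom R U -> R <> P -> R <> U -> weight R w < weight P w.
  move=> pR RU nP nU; rewrite ltnNge; apply/negP => h.
  have := maxU R; rewrite /good pR (dom_trans RU Uq) h eq_sym (introN eqP nP).
  by move=> /(_ isT); have := depth_lt RU nU; lia.
exists U; split=> //; split=> [R pR RU|].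
  case: (eqVneq R U) => [->//|/eqP nU]; case: (eqVneq R P) => [->//|/eqP nP].
  by have := low R pR RU nP nU; lia.
apply: depth_near => x; rewrite leqNgt; apply/negP => gap.
(* Both new states would score less than [P], yet together as much as [P] and [U]. *)
have [R1 [R2 [[p1 u1] [p2 u2] [np1 nu1 np2 nu2] /(_ w) e]]] := split_interval pU gap.
by have := low R1 p1 u1 np1 nu1; have := low R2 p2 u2 np2 nu2; lia.
Qed.

(** Mirror image of [short_up]: minimal depth puts [V] as close to [Q] as possible. *)
Lemma short_down P Q w : dom P Q -> P <> Q -> weight Q w <= weight P w ->
  exists V, [/\ dom P V, dom V Q, V <> Q, weight Q w <= weight V w
    & (forall R, dom V R -> dom R Q -> weight R w <= weight V w)
      /\ depth V <= depth Q + n.-1].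
Proof.
move=> pq ne le.
pose good V := [&& dom P V, dom V Q, V != Q & weight Q w <= weight V w].
have goodP : good P by rewrite /good pq dom_refl le (introN eqP ne).
case: (arg_minnP depth goodP) => V /and4P[pV Vq /eqP neV leV] minV.
have low R : dom V R -> dom R Q -> R <> V -> R <> Q -> weight R w < weight Q w.
  move=> VR RQ nV nQ; rewrite ltnNge; apply/negP => h.
  have := minV R; rewrite /good (dom_trans pV VR) RQ h (introN eqP nQ).
  by move=> /(_ isT); have := depth_lt VR (nesym nV); lia.
exists V; split=> //; split=> [R VR RQ|].
  case: (eqVneq R V) => [->//|/eqP nV]; case: (eqVneq R Q) => [->//|/eqP nQ].
  by have := low R VR RQ nV nQ; lia.
apply: depth_near => x; rewrite leqNgt; apply/negP => gap.
have [R1 [R2 [[p1 u1] [p2 u2] [np1 nu1 np2 nu2] /(_ w) e]]] := split_interval Vq gap.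
by have := low R1 p1 u1 np1 nu1; have := low R2 p2 u2 np2 nu2; lia.
Qed.

End States.

Arguments weight : simpl never.

(** * Scores of words along chains of states *)

Section Paths.
Variable n : nat.
Implicit Types (P Q R U : {set 'I_n}) (w s : seq 'I_n) (v : nat).

(* The score is at least [v]: by truncated subtraction, hits in excess of [v] are
   harmless. *)
Fixpoint attains w P Q v : Prop :=
  if w is i :: w' then
    exists2 R, dom P R & attains w' R Q (v - holds R i)
  else dom P Q && (v == 0).

Lemma attains_dom w P Q v : attains w P Q v -> dom P Q.
Proof.
elim: w P v => [|i w IH] P v /=; first by case/andP.
by case=> R pR /IH; apply: dom_trans.
Qed.

Lemma attains_le w P Q v v' : v' <= v -> attains w P Q v -> attains w P Q v'.
Proof.
elim: w P v v' => [|i w IH] P v v' /= le; first by case/andP=> -> /=; lia.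
by case=> R pR h; exists R => //; apply: IH h; lia.
Qed.

Lemma attains_mono w P P' Q v : dom P P' -> attains w P' Q v -> attains w P Q v.
Proof.
case: w => [|i w] /= pp'; first by case/andP=> h ->; rewrite (dom_trans pp' h).
by case=> R h; exists R => //; apply: dom_trans h.
Qed.

Lemma attains_cat w1 w2 P R Q v1 v2 :
  attains w1 P R v1 -> attains w2 R Q v2 -> attains (w1 ++ w2) P Q (v1 + v2).
Proof.
elim: w1 P v1 => [|i w IH] P v1 /=.
  by case/andP=> pR /eqP -> h; apply: attains_mono h.
case=> S pS h1 h2; exists S => //; apply: attains_le (IH _ _ h1 h2); lia.
Qed.

Lemma attains_split w1 w2 P Q v : attains (w1 ++ w2) P Q v ->
  exists R v1 v2, [/\ attains w1 P R v1, attains w2 R Q v2 & v <= v1 + v2].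
Proof.
elim: w1 P v => [|i w IH] P v /=.
  by move=> h; exists P, 0, v; rewrite dom_refl.
case=> S pS /IH[R [v1 [v2 [h1 h2 le]]]].
exists R, (v1 + holds S i), v2; split=> //; last by lia.
by exists S => //; rewrite addnK.
Qed.

Lemma attains_loop w P : attains w P P (weight P w).
Proof.
elim: w => [|i w IH] /=; first by rewrite dom_refl.
by exists P; rewrite ?dom_refl //; apply: attains_le IH; rewrite weight_cons; lia.
Qed.

Lemma attains_loop_le w P v : attains w P P v -> v <= weight P w.
Proof.
elim: w v => [|i w IH] v /=; first by case/andP=> _ /eqP ->.
case=> R pR h; have eR : R = P by apply: dom_anti (attains_dom h) pR.
by subst R; have := IH _ h; rewrite weight_cons; lia.
Qed.

(* Pointwise, the meet and the join of two states hold the same letters as the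
   two states, so no hit is lost when a path is cut at [U]. *)
Lemma attains_meet_join w P Q U v : #|P| = #|U| -> attains w P Q v ->
  exists v1 v2, [/\ attains w (meet P U) (meet Q U) v1,
    attains w (join P U) (join Q U) v2 & v + weight U w <= v1 + v2].
Proof.
elim: w P v => [|i w IH] P v e /=.
  case/andP=> pq /eqP ->; exists 0, 0; split=> //.
    by rewrite meet_dom ?dom_refl.
  by rewrite join_dom ?dom_refl.
case=> R pR h; have e' : #|R| = #|U| by case/domP: pR => _ <-.
have [v1 [v2 [h1 h2 le]]] := IH _ _ e' h.
exists (v1 + holds (meet R U) i), (v2 + holds (join R U) i); split.
- by exists (meet R U); rewrite ?addnK // meet_dom // dom_refl.
- by exists (join R U); rewrite ?addnK // join_dom // dom_refl.
have := meet_join_holds R U i; move: le; rewrite weight_cons; lia.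
Qed.

Lemma attains_via w P Q U v : dom P U -> dom U Q -> attains w P Q v ->
  exists v1 v2, [/\ attains w P U v1, attains w U Q v2
                  & v + weight U w <= v1 + v2].
Proof.
move=> pU uQ h; have e : #|P| = #|U| by case/domP: pU.
have := attains_meet_join e h.
by rewrite meet_l // meet_r // join_r // join_l.
Qed.

(** * Words composed of blocks of equal content *)

Section Substitution.
Variables (T : eqType) (block : T -> seq 'I_n) (w0 : seq 'I_n).
Hypothesis block_weight : forall x P, weight P (block x) = weight P w0.
Implicit Types (q z t : seq T).

Definition expand z := flatten (map block z).
Local Notation c P := (weight P w0).

Lemma expand_cat z1 z2 : expand (z1 ++ z2) = expand z1 ++ expand z2.
Proof. by rewrite /expand map_cat flatten_cat. Qed.

Lemma weight_expand P z : weight P (expand z) = size z * c P.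
Proof. by elim: z => //= x z IH; rewrite weight_cat IH block_weight mulSn. Qed.

Lemma attains_expand_loop z P : attains (expand z) P P (size z * c P).
Proof. by rewrite -weight_expand; apply: attains_loop. Qed.

(** Blocks on which the chain rests score at most [M] and are dropped; each block kept in [t] lowers
    the depth, which bounds the length of [t]. The last inequality, free of subtraction, allows a
    loss of [M] per dropped block. *)
Lemma extract_jumps z P U v M :
  (forall R, dom P R -> dom R U -> c R <= M) -> attains (expand z) P U v ->
  exists t v', [/\ size t + depth U <= depth P, attains (expand t) P U v'
                 & v + size t * M <= v' + size z * M].
Proof.
elim: z P v => [|x z IH] P v bound.
  case/andP=> pU /eqP ->; exists [::], 0.
  by split=> //=; rewrite ?pU ?depth_dom.
move=> /attains_split[R [v1 [v2 [h1 h2 le]]]].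
have pR := attains_dom h1.
have [|t [v' [st ht le']]] := IH R v2 _ h2.
  by move=> S RS; apply: bound; apply: dom_trans RS.
case: (eqVneq P R) h1 => [eR|/eqP neR] h1.
  subst R; exists t, v'; split=> //.
  have := attains_loop_le h1; rewrite block_weight.
  have := bound P (dom_refl P) (attains_dom h2); rewrite /= mulSn; lia.
exists (x :: t), (v1 + v'); split.
- by have := depth_lt pR neR; rewrite /=; lia.
- exact: attains_cat h1 ht.
- by rewrite /= !mulSn; lia.
Qed.

Variable q : seq T.
Variable m : nat.
Hypothesis q_rich : forall t, size t = m -> infix t q.

Lemma embed_jumps t P U v : size t <= m -> attains (expand t) P U v ->
  exists2 v', attains (expand q) P U v'
    & v + size q * minn (c P) (c U) <= v' + size t * minn (c P) (c U).
Proof.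
(* An empty [t] offers no letter for the padding below; in that case all of [q] is run at [U]. *)
move=> st h; case: t st h => [|x t] st h.
  case/andP: h => pU /eqP ->; exists (size q * minn (c P) (c U));
    last by rewrite add0n leq_addr.
  by apply: attains_mono pU _; apply: attains_le (attains_expand_loop q U);
    rewrite leq_mul2l geq_minr orbT.
pose r := nseq (m - size (x :: t)) x.
have /q_rich/infixP[q1 [q2 ->]] : size ((x :: t) ++ r) = m.
  by rewrite size_cat size_nseq subnKC.
(* The prefix [q1] is run at [P], the padding and the suffix [q2] at [U]. *)
exists (size q1 * c P + (v + size r * c U + size q2 * c U)).
  rewrite !expand_cat; apply: attains_cat (attains_expand_loop _ _) _.
  rewrite -catA -!addnA; apply: attains_cat h _.
  by apply: attains_cat; apply: attains_expand_loop.
rewrite !size_cat !mulnDl.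
have := leq_mul (leqnn (size q1)) (geq_minl (c P) (c U)).
have := leq_mul (leqnn (size q2)) (geq_minr (c P) (c U)).
have := leq_mul (leqnn (size r)) (geq_minr (c P) (c U)); lia.
Qed.

Lemma compress z P U v : depth P <= depth U + m ->
  (forall R, dom P R -> dom R U -> c R <= maxn (c P) (c U)) ->
  attains (expand z) P U v ->
  exists2 v', attains (expand q) P U v'
    & v + size q * minn (c P) (c U) <= v' + size z * maxn (c P) (c U).
Proof.
move=> near bound /(extract_jumps bound)[t [v1 [st h1 le1]]].
have [|v2 h2 le2] := embed_jumps _ h1; first by lia.
exists v2 => //.
have : size t * minn (c P) (c U) <= size t * maxn (c P) (c U).
  by rewrite leq_mul2l; lia.
lia.
Qed.

Hypothesis m_ge : n.-1 <= m.

(** Compressing the part from [P] to [U] loses at most [size z * c U], which the cut at [U] repays;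
    [size q * c P] is what the receiving copy of [q] scores when run at [P]. *)
Lemma move_left z P Q v : dom P Q -> P <> Q -> c P <= c Q ->
  attains (expand z) P Q v ->
  exists U v1 v2, [/\ dom P U /\ P <> U, attains (expand q) P U v1,
    attains (expand z) U Q v2 & size q * c P + v <= v1 + v2].
Proof.
move=> pq ne le h.
have [U [pU uQ neU leU [bound near]]] := short_up pq ne le.
have [v1 [v2 [h1 h2 le12]]] := attains_via pU uQ h.
have [||v' h' le'] := compress _ _ h1; first by lia.
  by move=> R pR RU; rewrite (maxn_idPr leU) bound.
exists U, v', v2; split=> //.
move: le' le12; rewrite weight_expand (maxn_idPr leU) (minn_idPl leU); lia.
Qed.

Lemma move_right z P Q v : dom P Q -> P <> Q -> c Q <= c P ->
  attains (expand z) P Q v ->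
  exists V v1 v2, [/\ dom V Q /\ V <> Q, attains (expand z) P V v1,
    attains (expand q) V Q v2 & v + size q * c Q <= v1 + v2].
Proof.
move=> pq ne le h.
have [V [pV vQ neV leV [bound near]]] := short_down pq ne le.
have [v1 [v2 [h1 h2 le12]]] := attains_via pV vQ h.
have [||v' h' le'] := compress _ _ h2; first by lia.
  by move=> R VR RQ; rewrite (maxn_idPl leV) bound.
exists V, v1, v'; split=> //.
move: le' le12; rewrite weight_expand (maxn_idPl leV) (minn_idPr leV); lia.
Qed.

Definition power k : seq T := flatten (nseq k q).

Lemma powerS k : power k.+1 = q ++ power k.
Proof. by []. Qed.

Lemma powerSr k : power k.+1 = power k ++ q.
Proof. by elim: k => [|k IH]; rewrite powerS ?cats0 // {1}IH catA. Qed.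

(** Each round uses up one copy of [q] and lowers the depth difference, so [r] copies on each side
    suffice even if all rounds fall on the same side. *)
Lemma exchange_middle r k l x y P Q v : depth P <= depth Q + r -> r <= k -> r <= l ->
  attains (expand (power k ++ x :: power l)) P Q v ->
  attains (expand (power k ++ y :: power l)) P Q v.
Proof.
elim: r k l P Q v => [|r IH] k l P Q v dep rk rl h.
all: have pQ := attains_dom h.
(* A constant chain scores by the length of the word alone, so the middle letter is irrelevant. *)
all: case: (eqVneq P Q) => [eQ|/eqP neQ];
  [subst Q; apply: attains_le (attains_expand_loop _ _); have := attains_loop_le h;
   by rewrite weight_expand !size_cat | have dlt := depth_lt pQ neQ].
  (* With [r = 0] the depths leave no room for [P <> Q]. *)
  by lia.
case: k rk h => // k rk h; case: l rl h => // l rl h.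
case: (leqP (c P) (c Q)) => [le|/ltnW le].
  have [U [v1 [v2 [[pU neU] h1 h2 le12]]]] : exists U v1 v2,
      [/\ dom P U /\ P <> U, attains (expand q) P U v1,
      attains (expand (power k ++ x :: power l.+1)) U Q v2 & v <= v1 + v2].
    move: h; rewrite powerS -catA expand_cat => /attains_split[R [v1 [v2 [h1 h2 le12]]]].
    (* If the chain has left [P] by the end of the first copy of [q], it is cut there; otherwise
       that copy is free to receive the jumps of [move_left]. *)
    case: (eqVneq P R) h1 => [eR|/eqP neR] h1; last first.
      by exists R, v1, v2; split=> //; split=> //; apply: attains_dom h1.
    subst R; have [U [u1 [u2 [pU g1 g2 le']]]] := move_left pQ neQ le h2.
    exists U, u1, u2; split=> //.
    by have := attains_loop_le h1; rewrite weight_expand; lia.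
  apply: attains_le le12 _; rewrite powerS -catA expand_cat.
  apply: attains_cat h1 _; apply: IH h2; [have := depth_lt pU neU; lia|lia|lia].
have [U [v1 [v2 [[pU neU] h1 h2 le12]]]] : exists U v1 v2,
    [/\ dom U Q /\ U <> Q, attains (expand (power k.+1 ++ x :: power l)) P U v1,
    attains (expand q) U Q v2 & v <= v1 + v2].
  move: h; rewrite (powerSr l) -cat_cons catA expand_cat.
  move=> /attains_split[R [v1 [v2 [h1 h2 le12]]]].
  case: (eqVneq R Q) h2 => [eR|/eqP neR] h2; last first.
    by exists R, v1, v2; split=> //; split=> //; apply: attains_dom h2.
  subst R; have [U [u1 [u2 [pU g1 g2 le']]]] := move_right pQ neQ le h1.
  exists U, u1, u2; split=> //.
  by have := attains_loop_le h2; rewrite weight_expand; lia.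
apply: attains_le le12 _; rewrite (powerSr l) -cat_cons catA expand_cat.
apply: attains_cat h2; apply: IH h1; [have := depth_lt pU neU; lia|lia|lia].
Qed.

End Substitution.
End Paths.

(** * Invariance under Knuth relations *)

(** On counting functions, this moves the largest element not exceeding [i] up to [i]. *)
Definition lower (f : nat -> nat) (i x : nat) : nat :=
  if x <= i then minn (f x) (f i.+1).-1 else f x.

Section Knuth.
Variable n : nat.
Implicit Types (P Q R U : {set 'I_n}) (w s : seq 'I_n) (v : nat).

Fixpoint hits s P Q : Prop :=
  if s is i :: s' then exists2 R, dom P R /\ i \in R & hits s' R Q else dom P Q.

Lemma hits_mono s P P' Q : dom P P' -> hits s P' Q -> hits s P Q.
Proof.
case: s => [|i s] /= pp'; first exact: dom_trans.
by case=> R [h iR] hs; exists R => //; split=> //; apply: dom_trans h.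
Qed.

(** Letters that miss can be skipped without moving, so the best score is the length of the longest
    subword hit in full. *)
Lemma attainsP w P Q v : attains w P Q v <->
  exists2 m, size m = size w & hits (mask m w) P Q /\ v <= size (mask m w).
Proof.
elim: w P v => [|i w IH] P v /=.
  split=> [/andP[h /eqP ->]|[[|//] _ [/= -> le]]]; first by exists [::].
  by rewrite -leqn0.
split=> [[R pR /IH[m sm [h le]]]|[[//|[] m] /= [sm]]].
- case: (boolP (i \in R)) => iR.
    exists (true :: m); rewrite /= ?sm //; split; first by exists R.
    by move: le; rewrite /holds iR; lia.
  exists (false :: m); rewrite /= ?sm //; split; first exact: hits_mono h.
  by move: le; rewrite /holds (negbTE iR) subn0.
- case=> -[R [pR iR] h] le; exists R => //; apply/IH; exists m => //; split=> //.
  by rewrite /holds iR; lia.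
- case=> h le; exists P; first exact: dom_refl.
  by apply/IH; exists m => //; split=> //; rewrite leq_subLR (leq_trans le) ?leq_addl.
Qed.

Definition raise P (i : 'I_n) : {set 'I_n} := of_profile n (lower (below P) i).

Lemma lower_profile P (i : 'I_n) : 0 < below P i.+1 -> profile n (lower (below P) i).
Proof.
move=> pos; split=> [|x _]; rewrite /lower; first by rewrite below0 min0n.
have := below_step P x; have := below_mono P (leqnSn x).
have := below_step P i.
case: (ltngtP x i) => [xi|xi|->]; rewrite ?ltnn ?(ltnW xi); try lia.
Qed.

Lemma below_raise P (i : 'I_n) x : 0 < below P i.+1 -> x <= n ->
  below (raise P i) x = lower (below P) i x.
Proof. by move=> pos; apply/below_of_profile/lower_profile. Qed.

Lemma card_raise P (i : 'I_n) : 0 < below P i.+1 -> #|raise P i| = #|P|.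
Proof.
move=> pos; rewrite card_of_profile ?/lower; last exact: lower_profile.
by rewrite leqNgt ltn_ord below_ge.
Qed.

Lemma raise_dom P (i : 'I_n) : 0 < below P i.+1 -> dom P (raise P i).
Proof.
move=> pos; apply: domI => [x xn|]; last by rewrite card_raise.
by rewrite below_raise // /lower; case: ifP => _ //; rewrite geq_minl.
Qed.

Lemma raise_mem P (i : 'I_n) : 0 < below P i.+1 -> i \in raise P i.
Proof.
move=> pos; rewrite mem_below !below_raise // /lower ?leqnn ?ltnn; last exact: ltnW.
have := below_step P i; lia.
Qed.

(** The greedy move is optimal, which makes the search for a chain deterministic. *)
Lemma raise_least P R (i : 'I_n) : dom P R -> i \in R ->
  0 < below P i.+1 /\ dom (raise P i) R.
Proof.
move=> /domP[pR e]; rewrite mem_below => iR.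
have pos : 0 < below P i.+1 by have := pR i.+1; lia.
split=> //; apply: domI => [x xn|]; last by rewrite card_raise.
rewrite below_raise // /lower; case: ifP => xi; last exact: pR.
have := pR x; have := pR i.+1; have := below_mono R xi; lia.
Qed.

Lemma hits_cons i s P Q :
  hits (i :: s) P Q <-> 0 < below P i.+1 /\ hits s (raise P i) Q.
Proof.
split=> [[R [pR iR] h]|[pos h]].
  by have [pos d] := raise_least pR iR; split=> //; apply: hits_mono h.
by exists (raise P i) => //; split; [apply: raise_dom|apply: raise_mem].
Qed.

End Knuth.

(** Knuth moves are checked on plain functions, by pointwise comparison; [g] stands for the counting
    function of the target state. *)
Fixpoint greedy (f : nat -> nat) (s : seq nat) (g : nat -> nat) : Prop :=
  if s is i :: s' then 0 < f i.+1 /\ greedy (lower f i) s' g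
  else forall x, g x <= f x.

Definition monotone (f : nat -> nat) := forall x y, x <= y -> f x <= f y.

Lemma lower_monotone f i : monotone f -> monotone (lower f i).
Proof.
move=> fm x y xy; rewrite /lower; have := fm x y xy.
case: (leqP y i) => yi; first by rewrite (leq_trans xy yi) /=; lia.
by case: (leqP x i) => xi /=; lia.
Qed.

Lemma greedy_mono f f' s g : (forall x, f x <= f' x) -> greedy f s g -> greedy f' s g.
Proof.
elim: s f f' => [|i s IH] f f' le /=; first by move=> h x; apply: leq_trans (h x) (le x).
case=> h h'; split; first exact: leq_trans (le _).
apply: IH h' => x; rewrite /lower; have := le x; have := le i.+1.
by case: ifP; lia.
Qed.

Lemma greedy_cons f i s s' g :
  (greedy (lower f i) s g -> greedy (lower f i) s' g) ->
  greedy f (i :: s) g -> greedy f (i :: s') g.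
Proof. by move=> h [fi /h]. Qed.

Section Swap.
Variables (f g : nat -> nat) (a b c : nat).
Hypothesis f_mono : monotone f.

(** With [a] first, a single element may serve both letters; with [c] first, two elements have to
    move. *)
Lemma lower_swap x : a < c -> lower (lower f c) a x <= lower (lower f a) c x.
Proof.
move=> ac; rewrite /lower ac (ltnNge c) (ltnW ac) /=.
have := f_mono ac; have := f_mono (ltnW ac : a.+1 <= c.+1).
by case: (leqP x a) => xa; case: (leqP x c) => xc; have := @f_mono x; lia.
Qed.

Lemma greedy_swap s : a < c -> greedy f [:: c, a & s] g -> greedy f [:: a, c & s] g.
Proof.
move=> ac /= [fc [fa h]]; split; [|split].
- by move: fa; rewrite /lower ac; lia.
- by rewrite /lower (ltnNge c) (ltnW ac).
- by apply: greedy_mono h => x; apply: lower_swap.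
Qed.

(** Some element lies in (a, c], so the two letters move different elements and their order is
    irrelevant. *)
Lemma greedy_unswap s : a < c -> f a.+1 < f c.+1 ->
  greedy f [:: a, c & s] g -> greedy f [:: c, a & s] g.
Proof.
move=> ac lt /= [fa [fc h]]; split; [|split].
- by move: fc; rewrite /lower (ltnNge c) (ltnW ac).
- by rewrite /lower ac; lia.
apply: greedy_mono h => x; rewrite /lower ac (ltnNge c) (ltnW ac) /=.
by case: (leqP x a) => xa; case: (leqP x c) => xc; lia.
Qed.

(** With no element in (a, c], one element moves to [a] and on to [c]; it can stop at [b] instead of
    [a]. *)
Lemma greedy_bc : a < b <= c -> f a.+1 = f c.+1 ->
  greedy f [:: a; c] g -> greedy f [:: b; c] g.
Proof.
case/andP=> ab bc e /= [fa [fc h]].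
have fb : f b.+1 = f c.+1.
  by have := @f_mono a.+1 b.+1; have := @f_mono b.+1 c.+1; lia.
split; [lia | split=> [|x]].
  by rewrite /lower (ltnNge c) bc /=; lia.
apply: leq_trans (h x) _; rewrite /lower !(ltnNge c) bc (leq_trans (ltnW ab) bc) /= fb e.
by case: (leqP x a) => xa; case: (leqP x b) => xb; case: (leqP x c) => xc; lia.
Qed.

(** Again one element makes both moves; stopping at [b] instead of [c] leaves it lower. *)
Lemma greedy_ab : a <= b < c -> f a.+1 = f c.+1 ->
  greedy f [:: a; c] g -> greedy f [:: a; b] g.
Proof.
case/andP=> ab bc e /= [fa [fc h]].
have fb : f b.+1 = f c.+1.
  by have := @f_mono a.+1 b.+1; have := @f_mono b.+1 c.+1; lia.
split; [lia | split=> [|x]].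
  by rewrite /lower (ltnNge b) ab /=; lia.
apply: leq_trans (h x) _; rewrite /lower !(ltnNge c) !(ltnNge b) ab.
rewrite (leq_trans ab (ltnW bc)) /= fb.
by case: (leqP x a) => xa; case: (leqP x b) => xb; case: (leqP x c) => xc; lia.
Qed.

(** With no element in (a, c], one element ends at [c] and a second at [b]; in the other order the
    second passes through [a], with the same outcome. *)
Lemma greedy_acb : a <= b < c ->
  greedy f [:: a; c; b] g -> greedy f [:: c; a; b] g.
Proof.
move=> abc h; have ac : a < c by lia.
case: (ltnP (f a.+1) (f c.+1)) => [lt|ge]; first exact: greedy_unswap.
case/andP: abc => ab bc; have e : f a.+1 = f c.+1.
  by apply/eqP; rewrite eqn_leq ge f_mono // ltnW.
have fb : f b.+1 = f c.+1.
  by have := @f_mono a.+1 b.+1; have := @f_mono b.+1 c.+1; lia.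
have ca : (c < a) = false by lia.
have cb : (c < b) = false by lia.
have ba : (b < a) = false by lia.
move: h; rewrite /= /lower bc ac ca ?cb ba /= ?e ?fb.
case=> fa [fc [fb' h]]; split; [|split; [|split=> [|x]]]; try lia.
apply: leq_trans (h x) _; move: fb'.
by case: (leqP x a) => xa; case: (leqP x b) => xb; case: (leqP x c) => xc; lia.
Qed.
End Swap.

Section KnuthInvariance.
Variable n : nat.
Implicit Types (P Q R U : {set 'I_n}) (w s : seq 'I_n) (v : nat).

Lemma below_monotone P : monotone (below P).
Proof. by move=> x y; apply: below_mono. Qed.

Lemma greedy_ext f f' (s : seq nat) g : f =1 f' -> greedy f s g -> greedy f' s g.
Proof. by move=> e; apply: greedy_mono => x; rewrite e. Qed.

Lemma hits_greedy s P Q : #|P| = #|Q| ->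
  hits s P Q <-> greedy (below P) [seq val i | i <- s] (below Q).
Proof.
elim: s P => [|i s IH] P e /=.
  by split=> [/domP[]|h]; last apply/domP.
have E (pos : 0 < below P i.+1) x : below (raise P i) x = lower (below P) i x.
  case: (leqP x n) => [xn|/ltnW nx]; first by rewrite below_raise.
  by rewrite below_ge // card_raise // /lower leqNgt (leq_trans (ltn_ord i)) // below_ge.
split=> [/hits_cons[pos /IH h]|[pos h]].
  by split=> //; apply: greedy_ext (E pos) _; apply: h; rewrite card_raise.
apply/hits_cons; split=> //; apply/IH; first by rewrite card_raise.
by apply: greedy_ext h => x; rewrite E.
Qed.

Lemma hits_card s P Q : hits s P Q -> #|P| = #|Q|.
Proof.
elim: s P => [|i s IH] P /=; first by case/domP.
by case=> R [/domP[_ ->] _] /IH.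
Qed.

Lemma hits_greedy_trans s s' P Q :
  (greedy (below P) [seq val i | i <- s] (below Q) ->
   greedy (below P) [seq val i | i <- s'] (below Q)) ->
  hits s P Q -> hits s' P Q.
Proof.
move=> h hs; have e := hits_card hs.
by apply/(hits_greedy _ e)/h/(hits_greedy _ e).
Qed.

Lemma attains_submask w w' P Q v :
  (forall m, size m = size w -> hits (mask m w) P Q ->
     exists2 m', size m' = size w' &
       hits (mask m' w') P Q /\ size (mask m w) <= size (mask m' w')) ->
  attains w P Q v -> attains w' P Q v.
Proof.
move=> sub /attainsP[m sm [h le]]; have [m' sm' [h' le']] := sub m sm h.
by apply/attainsP; exists m' => //; split=> //; apply: leq_trans le'.
Qed.

Arguments hits : simpl never.
Arguments greedy : simpl never.

Lemma attains_bca (a b c : 'I_n) P Q v : a < b -> b <= c ->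
  attains [:: b; c; a] P Q v <-> attains [:: b; a; c] P Q v.
Proof.
move=> ab bc; have ac := leq_trans ab bc; have fm := below_monotone P.
split; apply: attains_submask; case=> [|[] [|[] [|[] []]]] //= _ h.
- exists [:: true; true; true] => //; split=> //.
  apply: hits_greedy_trans h => /=; apply: greedy_cons.
  by apply: greedy_swap => //; apply: lower_monotone.
- by exists [:: true; false; true].
- by exists [:: true; true; false].
- by exists [:: true; false; false].
- exists [:: false; true; true] => //; split=> //.
  by apply: hits_greedy_trans h => /=; apply: greedy_swap.
- by exists [:: false; false; true].
- by exists [:: false; true; false].
- by exists [:: false; false; false].
- exists [:: true; true; true] => //; split=> //.
  apply: hits_greedy_trans h => /= h; have fb : 0 < below P b.+1 by case: h.
  move: h; apply: greedy_cons; apply: greedy_unswap => //.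
  (* Hitting [b] first leaves an element in (a, c], as [greedy_unswap] requires. *)
  rewrite /lower ab (ltnNge c) bc /=; have := fm b.+1 c.+1 bc; lia.
- by exists [:: true; false; true].
- by exists [:: true; true; false].
- by exists [:: true; false; false].
- case: (ltnP (below P a.+1) (below P c.+1)) => [lt|ge].
    exists [:: false; true; true] => //; split=> //.
    by apply: hits_greedy_trans h => /=; apply: greedy_unswap.
  (* The subword [ac] of [bac] is traded for the subword [bc] of [bca]. *)
  exists [:: true; true; false] => //; split=> //.
  apply: hits_greedy_trans h => /=; apply: greedy_bc; rewrite ?ab //.
  by apply/eqP; rewrite eqn_leq ge fm // ltnW.
- by exists [:: false; false; true].
- by exists [:: false; true; false].
- by exists [:: false; false; false].
Qed.

Lemma attains_cab (a b c : 'I_n) P Q v : a <= b -> b < c ->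
  attains [:: c; a; b] P Q v <-> attains [:: a; c; b] P Q v.
Proof.
move=> ab bc; have ac := leq_ltn_trans ab bc; have fm := below_monotone P.
split; apply: attains_submask; case=> [|[] [|[] [|[] []]]] //= _ h.
- exists [:: true; true; true] => //; split=> //.
  by apply: hits_greedy_trans h => /=; apply: greedy_swap.
- exists [:: true; true; false] => //; split=> //.
  by apply: hits_greedy_trans h => /=; apply: greedy_swap.
- by exists [:: false; true; true].
- by exists [:: false; true; false].
- by exists [:: true; false; true].
- by exists [:: true; false; false].
- by exists [:: false; false; true].
- by exists [:: false; false; false].
- exists [:: true; true; true] => //; split=> //.
  by apply: hits_greedy_trans h => /=; apply: greedy_acb; rewrite ?ab.
- case: (ltnP (below P a.+1) (below P c.+1)) => [lt|ge].
    exists [:: true; true; false] => //; split=> //.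
    by apply: hits_greedy_trans h => /=; apply: greedy_unswap.
  (* The subword [ac] of [acb] is traded for the subword [ab] of [cab]. *)
  exists [:: false; true; true] => //; split=> //.
  apply: hits_greedy_trans h => /=; apply: (greedy_ab (c := c)); rewrite ?ab //.
  by apply/eqP; rewrite eqn_leq ge fm // ltnW.
- by exists [:: false; true; true].
- by exists [:: false; true; false].
- by exists [:: true; false; true].
- by exists [:: true; false; false].
- by exists [:: false; false; true].
- by exists [:: false; false; false].
Qed.

Lemma attains_cat_equiv w1 w2 w1' w2' :
  (forall P Q v, attains w1 P Q v <-> attains w1' P Q v) ->
  (forall P Q v, attains w2 P Q v <-> attains w2' P Q v) ->
  forall P Q v, attains (w1 ++ w2) P Q v <-> attains (w1' ++ w2') P Q v.
Proof.
move=> e1 e2 P Q v; split=> /attains_split[R [v1 [v2 [/e1 h1 /e2 h2 le]]]];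
  exact: attains_le le (attains_cat h1 h2).
Qed.

Lemma attains_congruence w w' : congruence (@knuth n) w w' ->
  forall P Q v, attains w P Q v <-> attains w' P Q v.
Proof.
elim=> {w w'} [u v [a b c ab bc|a b c ab bc]|u|u v _ IH|u v w _ IH1 _ IH2
  |u u' v v' _ IH1 _ IH2] P Q k.
- exact: attains_bca.
- exact: attains_cab.
- by [].
- by split=> /IH.
- by split=> [/IH1/IH2|/IH2/IH1].
- exact: attains_cat_equiv.
Qed.

End KnuthInvariance.

(** * Column tableaux *)

Section Tableaux.
Variable n : nat.
Implicit Types (P Q R S : {set 'I_n}) (w s A B C D : seq 'I_n) (v x y t : nat).
Local Notation cong := (congruence (@knuth n)).

Lemma congruence_cat w1 w1' w2 w2' :
  cong w1 w1' -> cong w2 w2' -> cong (w1 ++ w2) (w1' ++ w2').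
Proof. exact: congruence_mul. Qed.

Definition decreasing C := sorted (fun i j : 'I_n => j < i) C.
Arguments decreasing : simpl never.

Lemma gtn_ord_trans : transitive (fun i j : 'I_n => j < i).
Proof. by move=> j i k ij jk; apply: ltn_trans jk ij. Qed.

Lemma decreasing_cons c C :
  decreasing (c :: C) = all (fun i : 'I_n => i < c) C && decreasing C.
Proof. exact: (path_sortedE gtn_ord_trans). Qed.

Lemma decreasing_cat A B : decreasing (A ++ B) =
  [&& decreasing A, decreasing B & all (fun i : 'I_n => all (fun j : 'I_n => j < i) B) A].
Proof.
elim: A => [|c A IH]; first by rewrite andbT.
rewrite cat_cons !decreasing_cons IH all_cat /=.
by do ![case: (all _ _) => //=]; rewrite ?andbF.
Qed.

Definition entries_below C t := count (fun i : 'I_n => i < t) C.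
Arguments entries_below : simpl never.

(** Schensted's column insertion: the letters of [B] are less than [x], so [c] is the smallest entry
    that is at least [x]. *)
Lemma bump_position (x : 'I_n) C : decreasing C ->
  (decreasing (x :: C)) \/
  exists A c B, [/\ C = A ++ c :: B, x <= c & decreasing (A ++ x :: B)].
Proof.
elim: C => [|c C IH]; first by left.
move=> dC; move: (dC); rewrite decreasing_cons => /andP[lt dC'].
case: (ltnP c x) => [cx|xc].
  left; rewrite decreasing_cons dC /= cx andbT.
  by apply: sub_all lt => i /ltn_trans; apply.
right; case: (IH dC') => [dx|[A [d [B [E xd dAB]]]]].
  by exists [::], c, C.
exists (c :: A), d, B; split=> //; first by rewrite E.
rewrite cat_cons decreasing_cons dAB andbT.
move: lt; rewrite E !all_cat /= => /and3P[-> dc ->]; rewrite andbT.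
exact: leq_ltn_trans dc.
Qed.

(* Moving [x] and then [c] through the letters between them by Knuth moves. *)
Lemma bump_congruence (x c : 'I_n) A B : decreasing (A ++ c :: B) -> x <= c ->
  decreasing (A ++ x :: B) -> cong (x :: A ++ c :: B) (A ++ x :: B ++ [:: c]).
Proof.
move=> dc xc dx; apply: (@congruence_trans _ _ _ (A ++ x :: c :: B)).
  elim: A dc {dx} => [|d A IH] dc; first exact: congruence_refl.
  move: (dc); rewrite cat_cons decreasing_cons => /andP[lt /IH {}IH].
  apply: (@congruence_trans _ _ _ (d :: x :: A ++ c :: B)); last first.
    exact: (congruence_cat (congruence_refl _ [:: d]) IH).
  (* To pass [d] by [knuth_cab], [x] needs a following letter [e] with [x <= e < d]: the next letter
     of [A], or [c] when [A] is exhausted. *)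
  have [e [E [-> xe ed]]] : exists e E, [/\ A ++ c :: B = e :: E, x <= e & e < d].
    case: A lt dc {IH} => [|e A] /=; first by case/andP=> cd _ _; exists c, B.
    case/andP=> ed _; rewrite decreasing_cons => /andP[_].
    rewrite decreasing_cons all_cat /= => /andP[/and3P[_ ce _] _].
    by exists e, (A ++ c :: B); split=> //; apply: leq_trans xc (ltnW ce).
  rewrite -[[:: x, d, e & E]]/([:: x; d; e] ++ E) -[[:: d, x, e & E]]/([:: d; x; e] ++ E).
  apply: congruence_cat (congruence_refl _ _).
  by apply/congruence_sym/congruence_rel/knuth_cab.
apply: congruence_cat (congruence_refl _ _) _.
move: dx dc; rewrite !decreasing_cat => /and3P[_ dx _] /and3P[_ dc _].
elim: B x xc dx dc => [|d B IH] x xc dx dc /=; first exact: congruence_refl.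
apply: (@congruence_trans _ _ _ (x :: d :: c :: B)).
  rewrite -[[:: x, c, d & B]]/([:: x; c; d] ++ B) -[[:: x, d, c & B]]/([:: x; d; c] ++ B).
  apply: congruence_cat (congruence_refl _ _).
  apply/congruence_rel/knuth_bca => //.
  by move: dx; rewrite decreasing_cons /= => /andP[/andP[]].
apply: (congruence_cat (congruence_refl _ [:: x])).
move: dx dc; rewrite !decreasing_cons /= => /andP[_ dx] /andP[/andP[dc lt] /andP[ltB dB]].
apply: IH; first exact: ltnW.
  by rewrite decreasing_cons ltB.
by rewrite decreasing_cons lt.
Qed.

(** Counting form of the row condition: [D] is no longer than [C], and its r-th smallest entry is at
    least that of [C]. *)
Definition tableau_step C D := forall t, entries_below D t <= entries_below C t.

Fixpoint tableau (Cs : seq (seq 'I_n)) : Prop :=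
  if Cs is C :: Cs' then
    [/\ C != [::], decreasing C, tableau_step C (head [::] Cs') & tableau Cs']
  else True.

Lemma entries_below_cat A B t :
  entries_below (A ++ B) t = entries_below A t + entries_below B t.
Proof. exact: count_cat. Qed.

Lemma entries_below_cons c B t : entries_below (c :: B) t = (c < t) + entries_below B t.
Proof. by []. Qed.

Lemma entries_below_all C t : all (fun i : 'I_n => i < t) C -> entries_below C t = size C.
Proof. by rewrite all_count => /eqP. Qed.

Lemma entries_below_none C t : all (fun i : 'I_n => t <= i) C -> entries_below C t = 0.
Proof.
move=> /allP h; apply/eqP; rewrite -leqn0 leqNgt -has_count; apply/hasPn => i /h.
by rewrite -leqNgt.
Qed.

Lemma entries_below_mono C t t' : t <= t' -> entries_below C t <= entries_below C t'.
Proof. by move=> tt; apply: sub_count => i /= /leq_trans; apply. Qed.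

(* The bound on the new first column is what lets a column that has just lost
   the letter [x] still precede it. *)
Lemma column_insertion (x : 'I_n) Cs : tableau Cs -> exists Cs',
  [/\ tableau Cs', cong (x :: flatten Cs) (flatten Cs')
    & forall t, entries_below (head [::] Cs') t <=
        maxn (entries_below (head [::] Cs) t)
             (if x < t then (entries_below (head [::] Cs) x).+1 else 0)].
Proof.
elim: Cs x => [|D Cs IH] x /=.
  move=> _; exists [:: [:: x]]; split=> //=; first exact: congruence_refl.
  by move=> t; rewrite /entries_below /=; case: ltnP.
case=> D0 dD step tab; case: (bump_position x dD) => [dxD|[A [c [B [E xc dAB]]]]].
  exists ((x :: D) :: Cs); split=> //=.
  - by split=> // t; rewrite entries_below_cons (leq_trans (step t)) // leq_addl.
  - exact: congruence_refl.
  move=> t; rewrite entries_below_cons; case: (ltnP x t) => xt; last by rewrite leq_max leqnn.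
  move: dxD; rewrite decreasing_cons => /andP[lt _].
  rewrite (entries_below_all lt) [entries_below D t]entries_below_all; first by lia.
  by apply: sub_all lt => i /ltn_trans; apply.
have [Cs' [tab' cg bound]] := IH c tab.
move: (dD); rewrite E decreasing_cat decreasing_cons => /and3P[_ /andP[ltB _] ltA].
move: (dAB); rewrite decreasing_cat decreasing_cons => /and3P[_ /andP[ltB' _] ltA'].
exists ((A ++ x :: B) :: Cs'); split=> /=.
- split=> //; first by case: (A).
  move=> t; apply: leq_trans (bound t) _; rewrite geq_max.
  have le (r : nat) : entries_below D r <= entries_below (A ++ x :: B) r.
    by rewrite E !entries_below_cat !entries_below_cons; lia.
  rewrite (leq_trans (step t) (le t)) /=; case: ltnP => // ct.
  (* The extra one in [bound] is paid for by [c], which [D] counts below [t] but not below [c]. *)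
  apply: leq_ltn_trans (step c) _; apply: leq_trans (le t).
  rewrite E !entries_below_cat !entries_below_cons ltnn ct.
  have := entries_below_mono A (ltnW ct); have := entries_below_mono B (ltnW ct); lia.
- apply: (@congruence_trans _ _ _ ((A ++ x :: B ++ [:: c]) ++ flatten Cs)).
    rewrite -cat_cons; apply: congruence_cat (congruence_refl _ _).
    by apply: bump_congruence; rewrite -?E.
  rewrite -!catA /= -catA /=.
  apply: congruence_cat (congruence_refl _ _) _.
  rewrite -!cat_cons; apply: congruence_cat (congruence_refl _ _) cg.
move=> t; rewrite !entries_below_cat !entries_below_cons.
case: (ltnP c t) => ct; first by rewrite (leq_ltn_trans xc ct) leq_max leqnn.
case: (ltnP x t) => xt; last by rewrite leq_max leqnn.
have geA : all (fun i : 'I_n => c <= i) A.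
  by apply: sub_all ltA => i /= /andP[/ltnW].
have A0 (r : nat) : r <= c -> entries_below A r = 0.
  by move=> rc; apply: entries_below_none; apply: sub_all geA => i; apply: leq_trans.
rewrite !A0 // (ltnNge c) xc /= (entries_below_all ltB') entries_below_all; first by lia.
by apply: sub_all ltB' => i /ltn_trans; apply.
Qed.

Lemma congruent_tableau w : exists2 Cs, tableau Cs & cong w (flatten Cs).
Proof.
elim: w => [|x w [Cs tab cg]]; first by exists [::] => //; apply: congruence_refl.
have [Cs' [tab' cg' _]] := column_insertion x tab; exists Cs' => //.
apply: congruence_trans cg'.
exact: (congruence_cat (congruence_refl _ [:: x]) cg).
Qed.

End Tableaux.

Arguments decreasing : simpl never.
Arguments entries_below : simpl never.

(** * Scores determine the tableau *)

Section Invariants.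
Variable n : nat.
Implicit Types (P Q R S : {set 'I_n}) (w s A B C D : seq 'I_n) (v x y t : nat).

Lemma entries_belowS C (i : 'I_n) : decreasing C ->
  entries_below C i.+1 = entries_below C i + (i \in C).
Proof.
elim: C => // c C IH; rewrite decreasing_cons => /andP[lt /IH e].
rewrite !entries_below_cons e inE; case: (eqVneq i c) => [->|ne] /=.
  have -> : c \in C = false by apply/negP => /(allP lt); rewrite ltnn.
  by rewrite ltnSn ltnn addn0 add0n addnC.
by rewrite ltnS leq_eqVlt val_eqE eq_sym (negbTE ne) addnA.
Qed.

Lemma entries_below_step C t : decreasing C ->
  entries_below C t.+1 <= (entries_below C t).+1.
Proof.
move=> dC; case: (ltnP t n) => tn.
  by rewrite (entries_belowS (Ordinal tn) dC) /=; case: (_ \in _); lia.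
by rewrite !entries_below_all ?leqnSn //; apply/allP => i _;
  rewrite (leq_trans (ltn_ord i)) // leqW.
Qed.

Lemma entries_below0 C : entries_below C 0 = 0.
Proof. by apply: entries_below_none; apply/allP. Qed.

Lemma entries_below_le C t : decreasing C -> entries_below C t <= t.
Proof.
move=> dC; elim: t => [|t IH]; first by rewrite entries_below0.
by have := entries_below_step t dC; lia.
Qed.

Lemma entries_below_ge C t : n <= t -> entries_below C t = size C.
Proof. by move=> nt; apply/entries_below_all/allP => i _; apply: leq_trans nt. Qed.

Lemma entries_below_inj C D : decreasing C -> decreasing D ->
  (forall t, entries_below C t = entries_below D t) -> C = D.
Proof.
move=> dC dD e; apply: (irr_sorted_eq (@gtn_ord_trans n)) => // [i|i]; first exact: ltnn.
have := e i.+1; rewrite !entries_belowS // e => /addnI.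
by case: (i \in C); case: (i \in D).
Qed.

(* The elements hit by the earlier, larger letters can only have moved up, so
   every letter uses up a new element of the state. *)
Lemma hits_decreasing s P Q t : decreasing s -> all (fun i : 'I_n => i < t) s ->
  hits s P Q -> size s <= below P t.
Proof.
elim: s P t => [|i s IH] P t; first by [].
rewrite decreasing_cons => /andP[lt ds] /andP[it _] [R [/domP[pR _] iR] h].
have := IH _ _ ds lt h; have := pR t; have := below_mono R it.
by move: iR; rewrite mem_below /=; lia.
Qed.

(** States only move up along a chain, so if the last one lies below [j], so do all those that are
    hit. *)
Lemma hits_bounded s P Q j : below Q j = #|Q| -> hits s P Q ->
  all (fun i : 'I_n => i < j) s.
Proof.
move=> Qj; elim: s P => // i s IH P [R [_ iR] h]; rewrite /= (IH R) // andbT.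
have e := hits_card h; rewrite ltnNge; apply/negP => ji.
have le : below Q j <= below R j.
  elim: s R h {IH iR e} => [|k s IH] R; first by case/domP.
  by case=> S [/domP[RS _] _] /IH le; apply: leq_trans le (RS j).
have := below_mono R ji; have := below_card R i.+1.
by move: iR; rewrite mem_below; lia.
Qed.

Lemma attains_column_le C P R v j : decreasing C -> below R j = #|R| ->
  attains C P R v -> v <= minn #|P| (entries_below C j).
Proof.
move=> dC Rj /attainsP[m sm [h le]]; apply: leq_trans le _.
have sub : subseq (mask m C) C by apply: mask_subseq.
rewrite leq_min; apply/andP; split.
  rewrite -(below_ge P (leqnn n)); apply: hits_decreasing h.
    exact: (subseq_sorted (@gtn_ord_trans n) sub dC).
  by apply/allP => i _; apply: ltn_ord.
have /entries_below_all <- := hits_bounded Rj h.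
exact: leq_count_subseq.
Qed.

(** For a tableau, this is the number of boxes in the first [k] rows of its restriction to the
    letters below [j]. *)
Definition truncated_size k j (Cs : seq (seq 'I_n)) :=
  \sum_(C <- Cs) minn k (entries_below C j).

Lemma attains_tableau_le Cs P Q v j : tableau Cs -> below Q j = #|Q| ->
  attains (flatten Cs) P Q v -> v <= truncated_size #|P| j Cs.
Proof.
rewrite /truncated_size; elim: Cs P v => [|C Cs IH] P v; first by move=> _ _ /andP[_ /eqP ->].
case=> _ dC _ tab Qj /attains_split[R [v1 [v2 [h1 h2 le]]]]; rewrite big_cons.
have /domP[_ e] := attains_dom h1; have /domP[RQ e'] := attains_dom h2.
have Rj : below R j = #|R|.
  by apply/eqP; rewrite eqn_leq below_card e' -Qj RQ.
have := attains_column_le dC Rj h1; have := IH _ _ tab Qj h2; rewrite e; lia.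
Qed.

Section LowerBound.
Variables k j : nat.
Hypotheses (kj : k <= j) (jn : j <= n).

(* The profile of the state made of the [minn k (entries_below C j)] smallest
   entries of [C] and of the largest remaining elements below [j]. *)
Definition column_profile C t := maxn (minn k (entries_below C t)) (k - (j - t)).
Definition column_state C : {set 'I_n} := of_profile n (column_profile C).
(** This is the least state with [k] elements; [column_state [::]] is the greatest one with all
    elements below [j]. *)
Definition initial_state : {set 'I_n} := of_profile n (minn k).

Lemma initial_profile : profile n (minn k).
Proof. by split=> [|t _]; [rewrite minn0|lia]. Qed.

Lemma column_profileP C : decreasing C -> profile n (column_profile C).
Proof.
move=> dC; split=> [|t _]; rewrite /column_profile ?entries_below0; first by lia.
have := entries_below_step t dC; have := entries_below_mono C (leqnSn t); lia.
Qed.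

Lemma card_initial : #|initial_state| = k.
Proof. rewrite card_of_profile; last exact: initial_profile. lia. Qed.

Lemma card_column C : decreasing C -> #|column_state C| = k.
Proof.
by move=> dC; rewrite card_of_profile; [rewrite /column_profile; lia|exact: column_profileP].
Qed.

Lemma column_state_bounded C : decreasing C -> below (column_state C) j = #|column_state C|.
Proof.
move=> dC; rewrite card_column // below_of_profile //; last exact: column_profileP.
by rewrite /column_profile; lia.
Qed.

Lemma initial_dom C : decreasing C -> dom initial_state (column_state C).
Proof.
move=> dC; apply: domI => [t tn|]; last by rewrite card_initial card_column.
rewrite !below_of_profile //; [|exact: initial_profile|exact: column_profileP].
by have := entries_below_le t dC; rewrite /column_profile; lia.
Qed.

Lemma column_dom C D : decreasing C -> decreasing D -> tableau_step C D ->
  dom (column_state C) (column_state D).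
Proof.
move=> dC dD step; apply: domI => [t tn|]; last by rewrite !card_column.
rewrite !below_of_profile //; [|exact: column_profileP..].
by have := step t; rewrite /column_profile; lia.
Qed.

Lemma count_smallest C : decreasing C ->
  count (fun i : 'I_n => (i < j) && (entries_below C i < k)) C = minn k (entries_below C j).
Proof.
elim: C => [|c C IH]; first by rewrite minn0.
rewrite decreasing_cons => /andP[lt dC] /=.
rewrite !entries_below_cons ltnn add0n (entries_below_all lt).
have -> : count (fun i : 'I_n => (i < j) && (entries_below (c :: C) i < k)) C
  = count (fun i : 'I_n => (i < j) && (entries_below C i < k)) C.
  apply: eq_in_count => i iC; rewrite entries_below_cons.
  by rewrite (ltnNge c) (ltnW (allP lt i iC)).
rewrite (IH dC); case: (ltnP c j) => [cj|_]; last by [].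
by rewrite entries_below_all; [lia|apply: sub_all lt => i /ltn_trans; apply].
Qed.

Lemma weight_column C : decreasing C ->
  minn k (entries_below C j) <= weight (column_state C) C.
Proof.
move=> dC; rewrite -(count_smallest dC) /weight -!size_filter.
rewrite !size_filter -!sum1_count [leqLHS]big_mkcond [leqRHS]big_mkcond /=.
rewrite !big_seq; apply: leq_sum => i iC.
case: ifP => // /andP[ij ik]; rewrite inE /column_profile entries_belowS // iC.
by case: ifP => // /negbT; lia.
Qed.

(** Each column is read at its own constant state, and the row condition makes these states
    increase. *)
Lemma attains_tableau_column Cs : tableau Cs ->
  attains (flatten Cs) (column_state (head [::] Cs)) (column_state [::])
    (truncated_size k j Cs).
Proof.
rewrite /truncated_size; elim: Cs => [|C Cs IH] /=; first by rewrite big_nil dom_refl.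
case=> _ dC step tab; rewrite big_cons.
apply: attains_cat.
  exact: attains_le (weight_column dC) (attains_loop _ _).
apply: attains_mono (IH tab); apply: column_dom => //.
by case: (Cs) tab => // D Ds [].
Qed.

Lemma attains_tableauP Cs v : tableau Cs ->
  attains (flatten Cs) initial_state (column_state [::]) v
  <-> v <= truncated_size k j Cs.
Proof.
move=> tab; split=> [h|le].
  rewrite -{1}card_initial.
  exact: attains_tableau_le tab (column_state_bounded (isT : decreasing [::])) h.
apply: attains_le le _; apply: attains_mono (attains_tableau_column tab).
by apply: initial_dom; case: (Cs) tab => // D Ds [].
Qed.

End LowerBound.

Lemma truncated_size_eq Cs Ds : tableau Cs -> tableau Ds ->
  (forall P Q v, attains (flatten Cs) P Q v <-> attains (flatten Ds) P Q v) ->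
  forall k j, truncated_size k j Cs = truncated_size k j Ds.
Proof.
move=> tC tD e.
have main k j : k <= j -> j <= n -> truncated_size k j Cs = truncated_size k j Ds.
  move=> kj jn; apply/eqP; rewrite eqn_leq; apply/andP; split.
    by apply/(attains_tableauP kj jn _ tD)/e/(attains_tableauP kj jn _ tC).
  by apply/(attains_tableauP kj jn _ tC)/e/(attains_tableauP kj jn _ tD).
(* Scores cover only [k <= j <= n]; a column has at most [j] entries below [j], so larger [k] change
   nothing. *)
have short l Es j : tableau Es -> j <= l -> truncated_size l j Es = truncated_size j j Es.
  move=> + jl; rewrite /truncated_size; elim: Es => [|E Es IH]; first by rewrite !big_nil.
  by case=> _ dE _ /IH; rewrite !big_cons => ->; have := entries_below_le j dE; lia.
have main2 k j : j <= n -> truncated_size k j Cs = truncated_size k j Ds.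
  move=> jn; case: (leqP k j) => [kj|/ltnW jk]; first exact: main.
  by rewrite !short // main.
move=> k j; case: (leqP j n) => [|/ltnW nj]; first exact: main2.
have trunc Es : truncated_size k j Es = truncated_size k n Es.
  by apply: eq_bigr => E _; rewrite !entries_below_ge.
by rewrite !trunc main2.
Qed.

Lemma truncated_size_max k j Cs : tableau Cs ->
  entries_below (head [::] Cs) j <= k -> truncated_size k.+1 j Cs = truncated_size k j Cs.
Proof.
rewrite /truncated_size; elim: Cs => [|C Cs IH]; first by rewrite !big_nil.
case=> _ _ step tab /= le; rewrite !big_cons IH //; last exact: leq_trans (step j) le.
by congr (_ + _); lia.
Qed.

Lemma truncated_size_mono k j Cs : truncated_size k j Cs <= truncated_size k.+1 j Cs.
Proof. by apply: leq_sum => C _; lia. Qed.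

(** The first column has the most entries below [j], and their number is the [k] at which the
    truncated sizes stop growing. *)
Lemma head_column_le C Cs D Ds : tableau (C :: Cs) -> tableau (D :: Ds) ->
  (forall k j, truncated_size k j (C :: Cs) = truncated_size k j (D :: Ds)) ->
  forall j, entries_below D j <= entries_below C j.
Proof.
move=> tC tD e j; rewrite leqNgt; apply/negP => lt.
have := truncated_size_max tC (leqnn (entries_below C j)).
rewrite !e /truncated_size !big_cons.
have := truncated_size_mono (entries_below C j) j Ds; rewrite /truncated_size; lia.
Qed.

Lemma nil_tableau D Ds : tableau (D :: Ds) ->
  ~ (forall k j, truncated_size k j [::] = truncated_size k j (D :: Ds)).
Proof.
case=> D0 _ _ _ /(_ 1 n); rewrite /truncated_size big_nil big_cons entries_below_ge //.
by case: D D0 => //= d D _; lia.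
Qed.

Lemma tableau_inj Cs Ds : tableau Cs -> tableau Ds ->
  (forall k j, truncated_size k j Cs = truncated_size k j Ds) -> Cs = Ds.
Proof.
elim: Cs Ds => [|C Cs IH] [|D Ds] // tC tD e.
- by case: (nil_tableau tD).
- by case: (nil_tableau tC) => k j; rewrite e.
have eCD : C = D.
  case: (tC) (tD) => [_ dC _ _] [_ dD _ _]; apply: entries_below_inj => // t.
  by apply/eqP; rewrite eqn_leq (head_column_le tD tC) // (head_column_le tC tD).
subst D; congr (_ :: _); case: tC tD => [_ _ _ tC] [_ _ _ tD]; apply: IH => // k j.
by have := e k j; rewrite /truncated_size !big_cons => /addnI.
Qed.

Theorem attains_complete w w' :
  (forall P Q v, attains w P Q v <-> attains w' P Q v) -> congruence (@knuth n) w w'.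
Proof.
move=> e; have [Cs tC cC] := congruent_tableau w; have [Ds tD cD] := congruent_tableau w'.
apply: congruence_trans (cC) _; apply: congruence_sym; apply: congruence_trans (cD) _.
have -> : Cs = Ds; last exact: congruence_refl.
apply: tableau_inj => //; apply: truncated_size_eq => // P Q v.
split=> [/(attains_congruence cC)/e/(attains_congruence cD)//|].
by move/(attains_congruence cD)/e/(attains_congruence cC).
Qed.

End Invariants.

(** * The identity *)

Lemma expg_power (q : word letter) k : (q ^+ k)%g = power q k.
Proof. by elim: k => [|k IH] //; rewrite powerS -IH expgS. Qed.

Definition double (x : letter) : word letter :=
  match x with a => [:: a; b] | b => [:: b; a] end.

Lemma subst_ab_baE (u : nonempty_word letter) :
  subst_ab_ba u = flatten (map double (u : word letter)) :> word letter.
Proof.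
rewrite /subst_ab_ba /subst /=.
elim: (u : word letter) => [|x s IH]; first by rewrite big_nil.
by rewrite big_cons IH; case: x.
Qed.

Lemma double_inj (s t : word letter) :
  flatten (map double s) = flatten (map double t) -> s = t.
Proof.
elim: s t => [|x s IH] [|y t] //=; [by case: y|by case: x|].
by case: x; case: y => //= -[/IH ->].
Qed.

Section Evaluation.
Local Open Scope quotient_scope.
Variables (n : nat) (phi : {multiplicative nonempty_word letter -> plactic n}).

Definition representative (x : letter) : word 'I_n :=
  repr (phi (generator x) : presented (@knuth n)).

Lemma morphism_eval (w : nonempty_word letter) :
  phi w = \pi_(presented (@knuth n)) (flatten (map representative (w : word letter))).
Proof.
case: w => -[//|x s] ne; elim: s x ne => [|y s IH] x ne.
  rewrite (_ : NonemptyWord ne = generator x); last exact: val_inj.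
  by rewrite /= cats0 reprK.
have ne' : is_nonempty (y :: s : word letter) by [].
rewrite (_ : NonemptyWord ne = (generator x * NonemptyWord ne')%g); last exact: val_inj.
rewrite gmulfM (IH y ne').
rewrite -[phi (generator x)](reprK (phi (generator x) : presented (@knuth n))).
exact: presented_mul_pi.
Qed.
End Evaluation.

Local Open Scope group_scope.

Theorem theorem4p1 (n : nat) (q : word letter) (u v : nonempty_word letter) :
  (0 < n)%N ->
  (forall p : word letter, size p = (n - 1)%N -> infix p q) ->
  let h := (n ^ 2 %/ 4)%N in
  u = q ^+ h * [:: a] * q ^+ h :> word letter ->
  v = q ^+ h * [:: b] * q ^+ h :> word letter ->
  is_identity (subst_ab_ba u) (subst_ab_ba v) /\
  satisfies (plactic n) (subst_ab_ba u) (subst_ab_ba v).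
Proof.
move=> _ rich h; rewrite !expg_power.
have mulE (s t : word letter) : s * t = s ++ t by [].
rewrite !mulE -!catA => eu ev; split=> [e|phi].
  have : u = v :> word letter by apply: double_inj; rewrite -!subst_ab_baE e.
  by rewrite eu ev => /eqP; rewrite eqseq_cat // eqxx.
pose block x := flatten (map (representative phi) (double x)).
(* The two blocks join the same two words in opposite orders. *)
have block_weight x P :
    weight P (block x) = weight P (representative phi a ++ representative phi b).
  by case: x; rewrite /block /= cats0 !weight_cat // addnC.
have evalE (w : nonempty_word letter) :
    flatten (map (representative phi) (subst_ab_ba w : word letter))
      = expand block (w : word letter).
  rewrite subst_ab_baE /expand; elim: (w : word letter) => //= x s IH.
  by rewrite map_cat flatten_cat IH.
rewrite !morphism_eval !evalE; apply/eqP/presented_eqP/attains_complete => P Q k.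
have exchange x y : attains (expand block (power q h ++ x :: power q h)) P Q k ->
    attains (expand block (power q h ++ y :: power q h)) P Q k.
  move=> hk; have range := depth_range (attains_dom hk).
  (* By [range], [h] rounds suffice, and there are [h] copies of [q] on each side. *)
  by apply: (exchange_middle block_weight rich) range _ _ hk; rewrite ?subn1.
by rewrite eu ev; split; apply: exchange.
Qed.
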